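(* Let $X$ be a weighted graph as described in the context, let $M\in\{A,L\}$ and $U(t)=e^{itM}$. Distinct vertices $u$ and $v$ are twins in $X$ if and only if, for every $t\in\mathbb{R}$, $U(t)_{u,u}=U(t)_{v,v}$, $U(t)_{u,v}=U(t)_{v,u}$, and $U(t)_{w,u}=U(t)_{w,v}$ for all $w\in V(X)\setminus\{u,v\}$. Moreover, if $u$ and $v$ are twins, then $U(t)_{u,u}\neq U(t)_{v,u}$ for every $t\in\mathbb{R}$.
   Context: $X$ is a connected weighted undirected graph with finite vertex set $V(X)$, with no multiple edges; loops are allowed, and every edge or loop carries a nonzero real weight, $\omega_{u,v}$ denoting the weight of edge $(u,v)$ and $\omega_{u,u}$ that of the loop at $u$. $A$ is the weighted adjacency matrix ($A_{u,v}=\omega_{u,v}$ if $u,v$ adjacent, including loops, else $0$), $D$ is diagonal with $\deg(u)=2\omega_{u,u}+\sum_j\omega_{u,j}$, and $L=D-A$. $N_X(u)$ is the set of neighbours of $u$. Two distinct vertices $u,v$ are twins if (1) $N_X(u)\setminus\{u,v\}=N_X(v)\setminus\{u,v\}$; (2) for each $w\in N_X(u)\setminus\{u,v\}$ the edges $(u,w)$ and $(v,w)$ have the same weight; (3) the loops on $u$ and $v$ have the same weight (zero if absent). The transition matrix is $U(t)=e^{itM}$. *)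

(* Defs.v *)
From HB Require Import structures.
From mathcomp Require Import all_boot all_order all_algebra.
From mathcomp Require Import all_classical all_reals all_analysis.
From mathcomp Require Import complex.

Set Implicit Arguments.
Unset Strict Implicit.
Unset Printing Implicit Defensive.

Import Order.TTheory GRing.Theory Num.Theory.
Import numFieldNormedType.Exports.

Local Open Scope ring_scope.
Local Open Scope complex_scope.

(* Edges and loops carry nonzero real weights, so the weight function, extended
   by 0 to the pairs that are not joined, determines the edge relation:
   u and v are adjacent (u has a loop, when u = v) iff wt u v != 0. *)
Record wgraph (R : realType) := WGraph {
  vertex : finType;
  wt : vertex -> vertex -> R;
  wt_sym : forall u v, wt u v = wt v u;
  wt_connected : forall u v, connect (fun x y => wt x y != 0) u v
}.

Section WeightedGraphs.
Variables (R : realType) (X : wgraph R).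
Implicit Types u v w : vertex X.

Definition adj : rel (vertex X) := fun u v => wt u v != 0.

Definition neighbours u : {set vertex X} := [set w | adj u w].

(* j ranges over all vertices, so the loop at u, if any, also occurs in
   the sum. *)
Definition wdeg u : R := 2 * wt u u + \sum_(j : vertex X) wt u j.

(* Vertices index matrices through the library enumeration of the vertex set. *)
Definition vmx (F : vertex X -> vertex X -> R) : 'M[R]_#|vertex X| :=
  \matrix_(i, j) F (enum_val i) (enum_val j).

Definition adjacency_mx : 'M[R]_#|vertex X| :=
  vmx (fun u v => if adj u v then wt u v else 0).

Definition degree_mx : 'M[R]_#|vertex X| :=
  vmx (fun u v => if u == v then wdeg u else 0).

Definition laplacian_mx : 'M[R]_#|vertex X| := degree_mx - adjacency_mx.

Definition twins u v : Prop :=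
  [/\ u != v,
      neighbours u :\: [set u; v] = neighbours v :\: [set u; v],
      forall w, w \in neighbours u :\: [set u; v] -> wt u w = wt v w
    & wt u u = wt v v].

End WeightedGraphs.

(* The matrix exponential, as the entrywise limit of the partial sums of
   \sum_k A ^+ k / k`! *)
Definition expmx (K : numFieldType) (n : nat) (A : 'M[K]_n) : 'M[K]_n :=
  \matrix_(i, j) limn (series (fun k => (A ^+ k) i j / k`!%:R)).

Definition transition_mx (R : realType) (n : nat) (M : 'M[R]_n) (t : R) :
    'M[R[i]]_n :=
  expmx (('i * t%:C) *: map_mx (real_complex R) M).

Definition transition (R : realType) (X : wgraph R)
    (M : 'M[R]_#|vertex X|) (t : R) (u v : vertex X) : R[i] :=
  transition_mx M t (enum_rank u) (enum_rank v).

(* Main.v *)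
(** Both conditions amount to the invariance of M under the transposition (u v),
    up to its symmetry.  Invariance passes to the powers of M, hence to U(t);
    conversely U(t) = 1 + i t M + O(t^2) determines M, read off the imaginary
    part.  If u and v are twins, then e_u - e_v is an eigenvector of M for some
    real theta, whence U(t)_{u,u} - U(t)_{u,v} = e^{i t theta} <> 0.  Convergence
    of the complex exponential series is reduced to that of its real and
    imaginary parts, the cosine and sine series weighted by the entries of M^k,
    which grow at most geometrically. *)

Require Import Defs.
From mathcomp Require Import all_boot all_order all_algebra.
From mathcomp Require Import all_classical all_reals all_analysis.
From mathcomp Require Import perm complex.

Set Implicit Arguments.
Unset Strict Implicit.

Local Open Scope ring_scope.

Import Order.TTheory GRing.Theory Num.Theory numFieldNormedType.Exports.
Local Open Scope complex_scope.

(** * Convergence of complex sequences through real and imaginary parts *)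

Lemma cvg_complex (R : realType) (a b : R^nat) (x y : R) :
  (a @ \oo --> x)%classic -> (b @ \oo --> y)%classic ->
  ((fun n => a n +i* b n : (R[i] : numFieldType)) @ \oo -->
    (x +i* y : (R[i] : numFieldType)))%classic.
Proof.
(* A positive element of [R[i]] is real, so the radius reduces to its real part [e]. *)
move=> ax yb; apply/cvgrPdist_lt => -[e e'] /[dup] /gtr0_real.
rewrite complex_real => /eqP -> {e'}; rewrite ltcR => e0.
have e2 : 0 < e / 2 by rewrite divr_gt0.
near=> n.
have -> : (x +i* y) - (a n +i* b n) = (x - a n)%:C + 'i * (y - b n)%:C.
  by rewrite [LHS]complexE.
apply: le_lt_trans (ler_normD _ _) _.
rewrite normrM !normc_def /= !expr0n /= !addr0 add0r expr1n sqrtr1 mul1r.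
rewrite !sqrtr_sqr -rmorphD ltcR [e]splitr ltrD //.
- by near: n; move/cvgrPdist_lt: ax; apply.
- by near: n; move/cvgrPdist_lt: yb; apply.
Unshelve. all: by end_near. Qed.

(** * Cosine and sine series weighted by a sequence of geometric growth *)

Section CoefficientSeries.
Variables (R : realType).
Implicit Types (t C : R) (m : R^nat).

Lemma complex_sum (a b : R^nat) n :
  \sum_(0 <= k < n) (a k +i* b k : R[i]) =
  (\sum_(0 <= k < n) a k) +i* (\sum_(0 <= k < n) b k).
Proof.
elim: n => [|n IHn]; first by rewrite !big_geq.
by rewrite !big_nat_recr //= IHn.
Qed.

Lemma norm_cos_coeff t k : `|cos_coeff t k| <= exp_coeff `|t| k.
Proof.
rewrite /cos_coeff /exp_coeff /= !normrM normfV !normr_nat !normrX normrN normr1.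
by rewrite expr1n mulr1; case: odd; rewrite ?mul0r ?mul1r.
Qed.

Lemma norm_sin_coeff t k : `|sin_coeff t k| <= exp_coeff `|t| k.
Proof.
rewrite /sin_coeff /exp_coeff /= !normrM normfV !normr_nat !normrX normrN normr1.
by rewrite expr1n mulr1; case: odd; rewrite ?mul0r ?mul1r.
Qed.

(** The terms are dominated by those of the exponential series at [|t| * C]. *)
Lemma is_cvg_series_coeffM (c m : R^nat) t C : 0 <= C ->
  (forall k, `|c k| <= exp_coeff `|t| k) -> (forall k, `|m k| <= C ^+ k) ->
  cvgn (series (fun k => c k * m k)).
Proof.
move=> C0 ct mC; apply: normed_cvg.
apply: (series_le_cvg _ _ _ (is_cvg_series_exp_coeff (`|t| * C))) => k //=.
- by rewrite exp_coeff_ge0 // mulr_ge0.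
- rewrite normrM /exp_coeff /= exprMn mulrAC; apply: ler_pM => //; exact: ct.
Qed.

(** The sine coefficients of index 0 and 1 are 0 and [t]; for [|t| <= 1] the term of index k >= 2 is
    at most t^2 C^k / k!, and these bounds sum to at most t^2 e^C. *)
Lemma sin_series_first_order m t C : 0 <= C -> (forall k, `|m k| <= C ^+ k) ->
  `|t| <= 1 ->
  `|limn (series (fun k => sin_coeff t k * m k)) - t * m 1%N|
    <= t ^+ 2 * expR C.
Proof.
move=> C0 mC t1.
have cvs := is_cvg_series_coeffM C0 (norm_sin_coeff t) mC.
set S := series _ in cvs *.
have cvd : ((`|S n - t * m 1%N|) @[n --> \oo] --> `|limn S - t * m 1%N|)%classic.
  by apply: cvg_norm; apply: cvgB => //; apply: cvg_cst.
rewrite -(cvg_lim (@norm_hausdorff _ _) cvd).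
apply: limr_le; first by apply/cvg_ex; eexists; exact: cvd.
(* From index 2 on, the partial sums contain the two leading terms, which can be split off. *)
exists 2%N => // -[|[|n]] //= _.
rewrite /S /series /= !big_nat_recl //= {1 2}/sin_coeff /= !mul0r add0r.
rewrite expr1 !mul1r divr1 addrC addKr.
apply: le_trans (ler_norm_sum _ _ _) _.
have le_exp : series (exp_coeff C) n.+2 <= expR C.
  apply: nondecreasing_cvgn_le (is_cvg_series_exp_coeff C) _.
  apply/nondecreasing_seqP => k; rewrite /series /= big_nat_recr //=.
  by rewrite lerDl exp_coeff_ge0.
apply: le_trans (ler_wpM2l (sqr_ge0 t) le_exp).
(* The terms 1 and [C] of the exponential sum are nonnegative and are dropped; the tails are
   compared termwise. *)
rewrite /series /= !big_nat_recl // [X in _ <= _ * X]addrA mulrDr -[leLHS]add0r.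
rewrite lerD //.
  by rewrite mulr_ge0 ?sqr_ge0 // addr_ge0 // exp_coeff_ge0.
rewrite mulr_sumr ler_sum // => k _; rewrite normrM.
rewrite [leRHS]mulrCA [leRHS]mulrC; apply: ler_pM => //.
apply: le_trans (norm_sin_coeff _ _) _; rewrite /exp_coeff /= ler_wpM2r //.
rewrite -[t ^+ 2]real_normK ?num_real // -addn2 exprD ler_piMl ?sqr_ge0 //.
by rewrite exprn_ile1.
Qed.

End CoefficientSeries.

(** * Entries of the transition matrix of a real matrix *)

Section TransitionEntries.
Variables (R : realType) (n : nat) (M : 'M[R]_n).

Lemma norm_mxX_le : exists2 C, 0 <= C &
  forall k i j, `|(M ^+ k) i j| <= C ^+ k.
Proof.
(* The sum of all absolute values bounds every absolute row sum, which is what the induction on the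
   exponent uses. *)
exists (\sum_i \sum_j `|M i j|) => [|k].
  by apply: sumr_ge0 => i _; apply: sumr_ge0.
elim: k => [|k IHk] i j; first by rewrite !expr0 mxE normr_nat lern1 leq_b1.
rewrite exprS mxE; apply: le_trans (ler_norm_sum _ _ _) _.
rewrite exprS.
have le_row : \sum_l `|M i l| <= \sum_i \sum_j `|M i j|.
  rewrite [leRHS](bigD1 i) //= lerDl.
  by apply: sumr_ge0 => l _; apply: sumr_ge0.
have C0 := le_trans (sumr_ge0 _ (fun l _ => normr_ge0 (M i l))) le_row.
apply: le_trans (ler_wpM2r (exprn_ge0 k C0) le_row).
rewrite mulr_suml ler_sum // => l _; rewrite normrM ler_wpM2l //; exact: IHk.
Qed.

Lemma scale_map_mxX (S : comNzRingType) (f : {rmorphism R -> S}) (z : S) k i j :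
  ((z *: map_mx f M) ^+ k) i j = z ^+ k * f ((M ^+ k) i j).
Proof.
have -> : (z *: map_mx f M) ^+ k = z ^+ k *: map_mx f (M ^+ k).
  elim: k => [|k IHk]; first by rewrite !expr0 scale1r map_mx1.
  rewrite !exprS IHk -!mulmxE map_mxM.
  by rewrite -scalemxAl -scalemxAr scalerA -exprS.
by rewrite !mxE.
Qed.

Lemma exp_i_term (t x : R) k :
  ('i * t%:C) ^+ k * x%:C / k`!%:R = (cos_coeff t k * x) +i* (sin_coeff t k * x).
Proof.
have -> : (k`!%:R : R[i]) = (k`!%:R)%:C by rewrite rmorph_nat.
have ik : ('i : R[i]) ^+ k =
    (~~ odd k)%:R * (-1) ^+ k./2 +i* ((odd k)%:R * (-1) ^+ k.-1./2).
  (* Write k as its parity plus twice its half; the even part contributes a power of i^2 = -1. *)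
  rewrite -{1}(odd_double_half k) -mul2n exprD exprM sqr_i.
  have -> : (-1 : R[i]) ^+ k./2 = ((-1) ^+ k./2)%:C by rewrite rmorphXn rmorphN1.
  case: (boolP (odd k)) => ok; last first.
    by rewrite expr0 /= !mul0r !mul1r.
  have -> : k.-1./2 = k./2.
    by rewrite -{1}(odd_double_half k) ok add1n /= doubleK.
  rewrite expr1; apply/eqP; rewrite eq_complex /=.
  by rewrite !mul0r !mul1r subr0 add0r !eqxx.
rewrite exprMn -rmorphXn -fmorphV -!mulrA -!rmorphM /= ik.
rewrite /cos_coeff /sin_coeff /=.
apply/eqP; rewrite eq_complex /= !mulr0 subr0 add0r !mulrA.
by rewrite !(mulrAC _ x) !eqxx.
Qed.

Lemma transition_mxE t i j :
  transition_mx M t i j =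
  limn (series (fun k => cos_coeff t k * (M ^+ k) i j)) +i*
  limn (series (fun k => sin_coeff t k * (M ^+ k) i j)).
Proof.
have [C C0 MC] := norm_mxX_le.
rewrite mxE; apply: (@cvg_lim (R[i] : numFieldType)); first exact: norm_hausdorff.
have cvc := is_cvg_series_coeffM C0 (norm_cos_coeff t) (fun k => MC k i j).
have cvs := is_cvg_series_coeffM C0 (norm_sin_coeff t) (fun k => MC k i j).
have := cvg_complex cvc cvs; apply: cvg_trans.
apply: near_eq_cvg; apply: nearW => N /=; rewrite /series /= -complex_sum.
by apply: eq_bigr => k _; rewrite scale_map_mxX exp_i_term.
Qed.

Lemma mxX_entries_perm (s : {perm 'I_n}) :
  (forall i j, M (s i) (s j) = M i j) ->
  forall k i j, (M ^+ k) (s i) (s j) = (M ^+ k) i j.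
Proof.
move=> Ms; elim=> [|k IHk] i j.
  by rewrite !expr0 !mxE (inj_eq perm_inj).
rewrite !exprS !mxE (reindex_inj (@perm_inj _ s)).
by apply: eq_bigr => l _; rewrite Ms IHk.
Qed.

Lemma transition_mx_perm (s : {perm 'I_n}) :
  (forall i j, M (s i) (s j) = M i j) ->
  forall t i j, transition_mx M t (s i) (s j) = transition_mx M t i j.
Proof.
move=> Ms t i j; rewrite !transition_mxE.
by congr (limn (series _) +i* limn (series _)); apply/funext => k;
  rewrite mxX_entries_perm.
Qed.

(** The imaginary part of each entry of U(t) is t times the entry of [M], up to t^2 e^C. Equal
    entries of U(t) thus force the entries of [M] to differ by at most 2 e^C t for every 0 < t <=
    1. *)
Lemma transition_mx_entry_inj i j i' j' :
  (forall t, transition_mx M t i j = transition_mx M t i' j') ->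
  M i j = M i' j'.
Proof.
have [C C0 MC] := norm_mxX_le.
move=> U_eq; apply/eqP; rewrite -subr_eq0 -normr_le0.
have le_t t : 0 < t -> t <= 1 -> `|M i j - M i' j'| <= 2 * expR C * t.
  move=> t0 t1; rewrite -(ler_pM2l t0) -{1}(gtr0_norm t0) -normrM mulrBr.
  move: (U_eq t); rewrite !transition_mxE => -[_ Im_eq].
  have tn1 : `|t| <= 1 by rewrite gtr0_norm.
  have := sin_series_first_order C0 (fun k => MC k i j) tn1.
  have := sin_series_first_order C0 (fun k => MC k i' j') tn1.
  rewrite Im_eq !expr1; set S := limn _ => le1 le2.
  have -> : t * M i j - t * M i' j' = (S - t * M i' j') - (S - t * M i j).
    by rewrite opprB [RHS]addrC subrKA.
  apply: le_trans (ler_normB _ _) _.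
  apply: le_trans (lerD le1 le2) _.
  by rewrite -mulrDr -mulr2n mulr_natl expr2 -mulrA [t * (_ *+ 2)]mulrC.
have K0 : 0 < 2 * expR C by rewrite mulr_gt0 ?expR_gt0.
apply/ler_addgt0Pl => e e0; rewrite addr0.
(* This choice of t makes 2 e^C t at most [e] while keeping t in the range of [le_t]. *)
have t0 : 0 < Num.min 1 (e / (2 * expR C)) by rewrite lt_min ltr01 divr_gt0.
apply: le_trans (le_t _ t0 _) _; first by rewrite ge_min lexx.
by rewrite mulrC -ler_pdivlMr // ge_min lexx orbT.
Qed.

(** The difference of the two entries is e^{i t theta}, with [theta] the eigenvalue of [d]; equality
    would make both cos and sin vanish at [t * theta]. *)
Lemma transition_mx_neq i j t :
  M i i = M j j -> M i j = M j i ->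
  (forall l, l != i -> l != j -> M l i = M l j) -> i != j ->
  transition_mx M t i i <> transition_mx M t i j.
Proof.
move=> Mii Mij Ml ij.
pose d : 'cV[R]_n := delta_mx i 0 - delta_mx j 0.
pose theta := M i i - M i j.
have Md : M *m d = theta *: d.
  apply/colP => l; rewrite mulmxBr -!colE !mxE !eqxx !andbT.
  have [->|li] := eqVneq l i; first by rewrite (negbTE ij) subr0 mulr1.
  have [->|lj] := eqVneq l j; first by rewrite sub0r mulrN1 opprB Mij Mii.
  by rewrite Ml // !subrr mulr0.
(* Coordinate [i] of M^k d = theta^k d. *)
have Xd k : (M ^+ k) i i - (M ^+ k) i j = theta ^+ k.
  have: (M ^+ k) *m d = theta ^+ k *: d.
    elim: k => [|k IHk]; first by rewrite !expr0 mul1mx scale1r.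
    rewrite exprSr -mulmxE -mulmxA Md -scalemxAr IHk scalerA.
    by rewrite exprS.
  move/colP/(_ i); rewrite mulmxBr -!colE !mxE !eqxx (negbTE ij) subr0 mulr1.
  by [].
have [C C0 MC] := norm_mxX_le.
have lim_diff (c : R^nat) : (forall k, `|c k| <= exp_coeff `|t| k) ->
    limn (series (fun k => c k * (M ^+ k) i i)) =
    limn (series (fun k => c k * (M ^+ k) i j)) ->
    limn (series (fun k => c k * theta ^+ k)) = 0.
  move=> ct lim_eq.
  have cvi := is_cvg_series_coeffM C0 ct (fun k => MC k i i).
  have cvj := is_cvg_series_coeffM C0 ct (fun k => MC k i j).
  have := cvgB cvi cvj; rewrite lim_eq subrr => cv0.
  apply/cvg_lim; first exact: norm_hausdorff.
  suff <- : series (fun k => c k * (M ^+ k) i i) -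
            series (fun k => c k * (M ^+ k) i j) =
            series (fun k => c k * theta ^+ k).
    exact: cv0.
  apply/funext => N; rewrite !fctE /series /= -sumrB.
  by apply: eq_bigr => k _; rewrite -mulrBr Xd.
rewrite !transition_mxE => -[Re_eq Im_eq].
(* The factor theta^k is absorbed into the cosine coefficient, giving the series at [t * theta];
   likewise for the sine below. *)
have cos0 : cos (t * theta) = 0.
  rewrite -(lim_diff _ (norm_cos_coeff t) Re_eq) unlock; congr (limn (series _)).
  by apply/funext => k; rewrite /cos_coeff /= exprMn -!mulrA (mulrC (theta ^+ k)).
have sin0 : sin (t * theta) = 0.
  rewrite -(lim_diff _ (norm_sin_coeff t) Im_eq) unlock; congr (limn (series _)).
  by apply/funext => k; rewrite /sin_coeff /= exprMn -!mulrA (mulrC (theta ^+ k)).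
have := cos2Dsin2 (t * theta); rewrite cos0 sin0 expr0n /= addr0.
by move/eqP; rewrite eq_sym oner_eq0.
Qed.

End TransitionEntries.

(** * Twins as invariance under a transposition of vertices *)

Section Twins.
Variables (R : realType) (X : wgraph R).
Implicit Types (u v w x y : vertex X) (F : vertex X -> vertex X -> R).

Lemma twins_wt u v w : twins u v -> w != u -> w != v -> wt u w = wt v w.
Proof.
case=> _ Nuv wt_uv _ wu wv.
have nbE x : (w \in neighbours x :\: [set u; v]) = (wt x w != 0).
  by rewrite !inE (negbTE wu) (negbTE wv).
have [wuw|] := boolP (w \in neighbours u :\: [set u; v]); first exact: wt_uv.
(* A vertex outside one reduced neighbourhood is outside the other, so both weights are 0. *)
move/[dup]; rewrite {1}Nuv !nbE !negbK => /eqP -> /eqP ->.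
by [].
Qed.

Lemma twins_wt_tperm u v : twins u v ->
  forall x y, wt (tperm u v x) (tperm u v y) = wt x y.
Proof.
move=> tw; have [_ _ _ wtuv] := tw.
have wt_w w : w <> u -> w <> v -> wt u w = wt v w.
  by move=> /eqP wu /eqP wv; apply: twins_wt.
move=> x y.
case: tpermP => [->|->|xu xv]; case: tpermP => [->|->|yu yv] //.
- exact: wt_sym.
- by rewrite wt_w.
- exact: wt_sym.
- by rewrite wt_w.
- by rewrite ![wt x _]wt_sym wt_w.
- by rewrite ![wt x _]wt_sym wt_w.
Qed.

(** Indexing by vertices rather than by their ranks lets [tperm u v] act directly. *)
Definition laplacian_entry x y : R := (if x == y then wdeg x else 0) - wt x y.

Lemma adjacency_mxE : adjacency_mx X = vmx (@wt R X).
Proof. by apply/matrixP => i j; rewrite !mxE /adj; case: eqP. Qed.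

Lemma laplacian_mxE : laplacian_mx X = vmx laplacian_entry.
Proof. by rewrite /laplacian_mx adjacency_mxE; apply/matrixP => i j; rewrite !mxE. Qed.

Lemma twins_laplacian_tperm u v : twins u v ->
  forall x y, laplacian_entry (tperm u v x) (tperm u v y) = laplacian_entry x y.
Proof.
move=> tw x y; have wts := twins_wt_tperm tw.
rewrite /laplacian_entry wts (inj_eq perm_inj) /wdeg wts.
(* The degree is invariant because the transposition permutes the summation index. *)
rewrite (reindex_inj (@perm_inj _ (tperm u v))).
by under eq_bigr do rewrite wts.
Qed.

Lemma wt_eq_twins u v : u != v -> wt u u = wt v v ->
  (forall w, w != u -> w != v -> wt w u = wt w v) -> twins u v.
Proof.
move=> uv wtuv wtw; split=> //.
  apply/setP => w; rewrite !inE negb_or.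
  have [//|wu] := eqVneq w u; have [//|wv] := eqVneq w v.
  by rewrite /= /adj !(wt_sym _ w) wtw.
move=> w; rewrite !inE negb_or -andbA => /and3P[wu wv _].
by rewrite !(wt_sym _ w) wtw.
Qed.

(** Off-diagonal entries give the weights to the other vertices. In the equality of diagonal entries
    these weights and that of the edge between [u] and [v] cancel, leaving twice the loop
    weights. *)
Lemma laplacian_eq_twins u v : u != v ->
  laplacian_entry u u = laplacian_entry v v ->
  (forall w, w != u -> w != v -> laplacian_entry w u = laplacian_entry w v) ->
  twins u v.
Proof.
move=> uv Luv Lw.
have wtw w : w != u -> w != v -> wt w u = wt w v.
  move=> wu wv; have := Lw w wu wv.
  by rewrite /laplacian_entry (negbTE wu) (negbTE wv) !sub0r => /oppr_inj.
apply: wt_eq_twins => //.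
move: Luv; rewrite /laplacian_entry !eqxx /wdeg.
rewrite (bigD1 u) // (bigD1 v) 1?eq_sym //= [in RHS](bigD1 v) // [in RHS](bigD1 u) //=.
rewrite (wt_sym v u).
have -> : \sum_(j | (j != v) && (j != u)) wt v j =
          \sum_(j | (j != u) && (j != v)) wt u j.
  apply: eq_big => [j|j /andP[jv ju]]; first by rewrite andbC.
  by rewrite !(wt_sym _ j) wtw.
set s := wt u v + _.
rewrite ![_ + s]addrC !addrA !addrK => /addIr/addIr.
by apply: mulfI; rewrite pnatr_eq0.
Qed.

(** Treats both matrices at once: [F] stands for the entries, and the hypotheses link twins to its
    symmetries in the two directions. *)
Lemma twins_transition F u v : u != v ->
  (forall x y, F x y = F y x) ->
  (twins u v -> forall x y, F (tperm u v x) (tperm u v y) = F x y) ->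
  (F u u = F v v -> (forall w, w != u -> w != v -> F w u = F w v) ->
    twins u v) ->
  (twins u v <->
    forall t : R,
      [/\ transition (vmx F) t u u = transition (vmx F) t v v,
          transition (vmx F) t u v = transition (vmx F) t v u
        & forall w : vertex X, w != u -> w != v ->
            transition (vmx F) t w u = transition (vmx F) t w v]) /\
  (twins u v -> forall t : R,
    transition (vmx F) t u u <> transition (vmx F) t v u).
Proof.
move=> uv Fsym Ftw twF.
have U_tperm : twins u v -> forall t x y,
    transition (vmx F) t (tperm u v x) (tperm u v y) =
    transition (vmx F) t x y.
  (* Ranking vertices carries the transposition of [u] and [v] to that of their indices. *)
  move=> /Ftw FE t x y; rewrite /transition !(inj_tperm _ _ _ (@enum_rank_inj _)).
  apply: transition_mx_perm => i j; rewrite !mxE.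
  by rewrite !(inj_tperm _ _ _ (@enum_val_inj _ _)) !enum_rankK FE.
split; first split.
- move=> tw t; have Ut := U_tperm tw t; split.
  + by rewrite -Ut tpermL.
  + by rewrite -Ut tpermL tpermR.
  + by move=> w wu wv; rewrite -Ut tpermL tpermD // eq_sym.
- move=> U_eq.
  have Fval x y : F x y = vmx F (enum_rank x) (enum_rank y).
    by rewrite mxE !enum_rankK.
  apply: twF => [|w wu wv]; rewrite !Fval; apply: transition_mx_entry_inj => t.
  + by case: (U_eq t).
  + by case: (U_eq t) => _ _; apply.
(* Invariance turns U(t)_{v,u} into U(t)_{u,v}, the form handled by [transition_mx_neq]. *)
- move=> tw t; rewrite -[transition _ _ v u](U_tperm tw) tpermL tpermR.
  have FE := Ftw tw.
  apply: transition_mx_neq; rewrite ?mxE ?enum_rankK //.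
  + by rewrite -FE tpermL.
  + move=> l lu lv; rewrite !mxE !enum_rankK -FE tpermL tpermD //.
      by rewrite -(inj_eq enum_rank_inj) enum_valK eq_sym.
    by rewrite -(inj_eq enum_rank_inj) enum_valK eq_sym.
  + by rewrite (inj_eq enum_rank_inj).
Qed.

End Twins.

Theorem theorem2p4 (R : realType) (X : wgraph R) (M : 'M[R]_#|vertex X|)
    (hM : M = adjacency_mx X \/ M = laplacian_mx X)
    (u v : vertex X) (huv : u != v) :
  (twins u v <->
    forall t : R,
      [/\ transition M t u u = transition M t v v,
          transition M t u v = transition M t v u
        & forall w : vertex X, w != u -> w != v ->
            transition M t w u = transition M t w v]) /\
  (twins u v -> forall t : R, transition M t u u <> transition M t v u).
Proof.
case: hM => ->.
  rewrite adjacency_mxE; apply: twins_transition => //.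
  - exact: wt_sym.
  - exact: twins_wt_tperm.
  - exact: wt_eq_twins.
rewrite laplacian_mxE; apply: twins_transition => //.
- move=> x y; rewrite /laplacian_entry wt_sym eq_sym.
  by have [->|] := eqVneq.
- exact: twins_laplacian_tperm.
- exact: laplacian_eq_twins.
Qed.
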